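(* For every connected outerplanar graph $H$, there is a connected outerplanar graph $G$ such that $H$ is an induced subgraph of $G$ and $G$ is not proper conflict-free $({\rm degree}+1)$-choosable.
   Context: All graphs are simple, finite and undirected. $\mathbb{N}$ is the set of positive integers; $N_G(v)$ is the open neighborhood of $v$ in $G$ and $d_G(v)$ its degree. A proper coloring of $G$ is a map $\phi:V(G)\to\mathbb{N}$ with $\phi(u)\neq\phi(v)$ for every edge $uv\in E(G)$. A proper conflict-free coloring of $G$ is a proper coloring $\phi$ of $G$ such that for every non-isolated vertex $v\in V(G)$ there is a color $c$ with $|\phi^{-1}(c)\cap N_G(v)|=1$. A list assignment $L$ of $G$ is a map from $V(G)$ to the power set of $\mathbb{N}$. A proper conflict-free $L$-coloring of $G$ is a proper conflict-free coloring $\phi$ of $G$ with $\phi(v)\in L(v)$ for every $v\in V(G)$. For a non-negative integer $k$, $G$ is proper conflict-free $({\rm degree}+k)$-choosable if $G$ admits a proper conflict-free $L$-coloring for every list assignment $L$ of $G$ satisfying $|L(v)|\geq d_G(v)+k$ for every $v\in V(G)$. A graph is outerplanar if it has a planar embedding with all vertices on the boundary of the outer face. *)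

(* Defs.v *)
(* Libraries: MathComp and MathComp-Analysis. *)
From HB Require Import structures.
From mathcomp Require Import all_boot all_order all_algebra.
From mathcomp Require Import all_classical all_reals all_analysis.

Set Implicit Arguments.
Unset Strict Implicit.
Unset Printing Implicit Defensive.

Import Order.TTheory GRing.Theory Num.Theory.
Import numFieldNormedType.Exports.

Local Open Scope classical_set_scope.
Local Open Scope ring_scope.

Record sgraph := SGraph {
  vertex :> finType;
  adj : rel vertex;
  adj_sym : symmetric adj;
  adj_irr : irreflexive adj
}.

Definition neighborhood (G : sgraph) (v : G) : {set G} :=
  [set u | adj v u]%SET.

Definition degree (G : sgraph) (v : G) : nat := #|neighborhood v|.

(* The graph without vertices is not considered connected. *)
Definition connected_graph (G : sgraph) : Prop :=
  (0 < #|G|)%N /\ forall u v : G, connect (@adj G) u v.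

(* H is, up to isomorphism, an induced subgraph of G. *)
Definition induced_subgraph (H G : sgraph) : Prop :=
  exists f : H -> G,
    injective f /\ forall u v : H, adj (f u) (f v) = adj u v.

Notation color := {n : nat | (0 < n)%N}.

Section Coloring.
Variable G : sgraph.

Definition proper_coloring (phi : G -> color) : Prop :=
  forall u v : G, adj u v -> phi u != phi v.

Definition proper_conflict_free (phi : G -> color) : Prop :=
  proper_coloring phi /\
  forall v : G, neighborhood v != finset.set0 ->
    exists c : color, #|[set u in neighborhood v | phi u == c]%SET| = 1%N.

Definition pcf_list_coloring (L : G -> set color) (phi : G -> color) : Prop :=
  proper_conflict_free phi /\ forall v : G, L v (phi v).

(* Lists may be infinite: [`I_m #<= A] says that A has at least m elements. *)
Definition pcf_degree_choosable (k : nat) : Prop :=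
  forall L : G -> set color,
    (forall v : G, `I_(degree v + k)%N #<= L v)%card ->
    exists phi : G -> color, pcf_list_coloring L phi.

End Coloring.

Section Drawing.
Variable R : realType.

Notation plane := (R * R)%type.

Definition segment (a b : plane) : set plane :=
  [set (1 - t) *: a + t *: b | t in `[0 : R, 1]].

(* As is usual in graph theory, the edges of a plane graph are drawn as
   polygonal arcs: finite unions of segments homeomorphic to [0, 1]
   (a continuous injection on the compact [0, 1] is a homeomorphism onto its
   image). *)
Definition polygonal_arc (x y : plane) (A : set plane) : Prop :=
  (exists g : R -> plane,
     [/\ {within `[0 : R, 1], continuous g}, set_inj `[0 : R, 1] g,
         g 0 = x, g 1 = y & g @` `[0 : R, 1] = A]) /\
  (exists s : seq (plane * plane),
     A = \bigcup_(ab in [set` s]) segment ab.1 ab.2).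

Section Embedding.
Variables (G : sgraph) (pos : G -> plane) (arc : G -> G -> set plane).

Definition arc_interior (u v : G) : set plane :=
  arc u v `\` [set pos u; pos v].

Definition planar_embedding : Prop :=
  [/\ injective pos,
      forall u v : G, adj u v ->
        arc u v = arc v u /\ polygonal_arc (pos u) (pos v) (arc u v),
      forall u v w : G, adj u v -> ~ arc_interior u v (pos w)
    & forall u v u' v' : G, adj u v -> adj u' v' ->
        [set u; v]%SET != [set u'; v']%SET ->
        arc_interior u v `&` arc u' v' = set0].

Definition drawing : set plane :=
  range pos `|` \bigcup_(e in [set e : G * G | adj e.1 e.2]) arc e.1 e.2.

Definition face (F : set plane) : Prop :=
  exists2 x, (~` drawing) x & F = connected_component (~` drawing) x.

Definition outer_face (F : set plane) : Prop := face F /\ ~ bounded_set F.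

End Embedding.

Definition boundary (F : set plane) : set plane := closure F `\` interior F.

Definition outerplanar (G : sgraph) : Prop :=
  exists (pos : G -> plane) (arc : G -> G -> set plane) (F : set plane),
    [/\ planar_embedding pos arc, outer_face pos arc F &
        forall v : G, boundary F (pos v)].

End Drawing.

(* Main.v *)
Require Import Defs.
From mathcomp Require Import all_boot all_order all_algebra.
From mathcomp Require Import all_classical all_reals all_analysis.
From mathcomp Require Import ring lra zify.

Set Implicit Arguments.
Unset Strict Implicit.
Unset Printing Implicit Defensive.

Import Order.TTheory GRing.Theory Num.Theory.
Import numFieldNormedType.Exports.

Local Open Scope classical_set_scope.
Local Open Scope ring_scope.

(** Attach to a vertex v of H, by one new edge, a knot w at which two new
    pentagons are glued together.  Give the four other vertices of one pentagon
    the list {1, 2, 3}, those of the other {4, 5, 6}, the knot {1, ..., 6}, and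
    every old vertex all colors.  The knot has degree 5 and the pentagon
    vertices degree 2, so these lists have size at least degree + 1.  At a
    vertex of degree 2 a conflict-free coloring gives the two neighbors
    different colors; hence three consecutive vertices of a pentagon use up its
    three colors and all of them differ from the color of the knot
    ([pentagon_excludes]).  Nothing is left for the knot
    ([attach_not_choosable]), whatever H is.

    The real work is to draw the gadget without hiding a vertex from the outer
    face.  Let p be the position of v and F the outer face of H.  The drawing D
    of H is a finite union of segments, so near p it consists of radii:
    if D meets the segment from p to a nearby point x anywhere but at p, then x
    itself is in D ([drawing_ray_closed]).  Since F comes arbitrarily close to
    p, it contains a point x near p, hence a ball around x, hence the open cone
    from p to this ball ([wedge_chart]).  An affine chart places a fixed wedge
    in that cone.

    In the wedge, the gadget is placed inside a closed convex set, the cap,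
    bounded above by the parabola t = 20 - s^2.  The nine new vertices lie on
    the parabola and the edges are straight.  The cap is star-shaped about p, so
    every point of the wedge outside the cap escapes outwards along its ray to
    the top of the wedge.  Thus the wedge minus the cap lies in a single face of
    the new drawing, and a clopen argument in the connected set F shows that all
    of F minus the cap lies in that face ([face_sub]).  That face is therefore
    unbounded, and it still has all old vertices, the point p and the points of
    the parabola in its closure.

    The new edges do not cross: for each of them there is a line that contains
    it and has each other new edge on one side ([separating_line]). *)

(** * Attaching two pentagons with a common vertex *)

(** The pentagons are 0 1 2 3 4 and 4 5 6 7 8, with common vertex 4.  The
    numbering follows the order of the vertices along the parabola on which they
    are drawn, so that the only chords between non-consecutive vertices are 04
    and 48. *)
Definition bowtie : rel nat := fun i j =>
  [|| i.+1 == j, j.+1 == i | (i, j) \in [:: (0, 4); (4, 0); (4, 8); (8, 4)]].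

Lemma bowtie_sym : symmetric bowtie.
Proof.
move=> i j; rewrite /bowtie !inE !xpair_eqE.
by apply/idP/idP; lia.
Qed.

Lemma bowtie_irr : irreflexive bowtie.
Proof. by move=> i; rewrite /bowtie !inE !xpair_eqE; lia. Qed.

Section Attach.
Variables (H : sgraph) (v : H).

Definition knot : 'I_9 := @Ordinal 9 4 isT.

Definition attach_rel : rel (H + 'I_9) := fun x y =>
  match x, y with
  | inl a, inl b => adj a b
  | inr i, inr j => bowtie i j
  | inl a, inr i | inr i, inl a => (a == v) && (i == knot)
  end.

Lemma attach_sym : symmetric attach_rel.
Proof. by move=> [a|i] [b|j] //=; [exact: adj_sym|exact: bowtie_sym]. Qed.

Lemma attach_irr : irreflexive attach_rel.
Proof. by move=> [a|i] /=; [exact: adj_irr|exact: bowtie_irr]. Qed.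

Definition attach : sgraph := SGraph attach_sym attach_irr.

Lemma attach_induced : induced_subgraph H attach.
Proof. by exists inl; split=> // a b [->]. Qed.

Lemma attach_connected : connected_graph H -> connected_graph attach.
Proof.
move=> [_ conH].
have conn_sym : connect_sym (@adj attach) by exact/sym_connect_sym/attach_sym.
have knotc (j : nat) (lj : (j < 9)%N) :
    connect (@adj attach) (inr (Ordinal lj) : attach) (inr knot : attach).
  have up i (li : (i < 9)%N) : (4 + i < 9)%N -> connect (@adj attach)
     (inr (inord (4 + i)) : attach) (inr knot : attach).
    elim: i {li} => [|i IH] li.
      by rewrite (_ : inord _ = knot) //; apply: val_inj; rewrite /= inordK.
    apply: connect_trans (IH _); last by lia.
    apply: connect1; rewrite /= /bowtie !inordK //; lia.
  have dn i : (i <= 4)%N -> connect (@adj attach)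
     (inr (inord (4 - i)) : attach) (inr knot : attach).
    elim: i => [|i IH] li.
      by rewrite (_ : inord _ = knot) //; apply: val_inj; rewrite /= inordK.
    apply: connect_trans (IH _); last by lia.
    apply: connect1; rewrite /= /bowtie !inordK //; lia.
  case: (leqP 4 j) => j4.
    rewrite (_ : Ordinal lj = inord (4 + (j - 4))); first by apply: up; lia.
    by apply: val_inj; rewrite /= inordK; lia.
  rewrite (_ : Ordinal lj = inord (4 - (4 - j))); first by apply: dn; lia.
  by apply: val_inj; rewrite /= inordK; lia.
have lift a b : connect (@adj H) a b ->
    connect (@adj attach) (inl a : attach) (inl b : attach).
  move=> /connectP [p + ->].
  elim: p a => [|c p IH] a //= /andP [ac /IH].
  by apply: connect_trans; apply: connect1.
have tov (x : attach) : connect (@adj attach) x (inl v : attach).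
  case: x => [a|[j lj]]; first exact/lift/conH.
  apply: connect_trans (knotc j lj) _.
  by apply: connect1; rewrite /= !eqxx.
split; first by apply/card_gt0P; exists (inl v).
by move=> x y; apply: connect_trans (tov x) _; rewrite conn_sym.
Qed.

End Attach.

(** * The attached graph is not choosable *)

(** If the two neighbors shared a color, each color would occur on none or on
    both of them. *)
Lemma conflict_free_deg2 (G : sgraph) (phi : G -> color) (x a b : G) :
  proper_conflict_free phi -> neighborhood x = [set a; b]%SET -> a != b ->
  phi a != phi b.
Proof.
move=> [_ cf] Nx ab; apply/eqP => eqab.
have [|c] := cf x; first by apply/finset.set0Pn; exists a; rewrite Nx !inE eqxx.
rewrite Nx; have [eqc|neqc] := eqVneq (phi a) c.
  rewrite (_ : [set u in _ | _]%SET = [set a; b]%SET) ?cards2 ?ab //.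
  apply/setP => u; rewrite !inE andb_idr // => /orP [] /eqP -> ; rewrite -?eqab;
    exact/eqP.
rewrite (_ : [set u in _ | _]%SET = finset.set0) ?cards0 //.
apply/setP => u; rewrite !inE; apply/negbTE/negP => /andP [/orP []] /eqP ->;
  by rewrite -?eqab (negbTE neqc).
Qed.

Definition color_range (a m : nat) : set color :=
  [set c | (a < val c <= a + m)%N].

Lemma color_range_card a m : (`I_m #<= color_range a m)%card.
Proof.
pose f (i : nat) : color := Sub (a + i).+1 (ltn0Sn _).
have injf : {in `I_m &, injective f}.
  by move=> i j _ _ /(congr1 val) /= /succn_inj /addnI.
rewrite -(card_le_eql (inj_card_eq injf)); apply: subset_card_le.
by move=> _ [i /= im <-]; rewrite /color_range /=; lia.
Qed.

(** In the pentagon w a1 a2 a3 a4, adjacent vertices differ by properness and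
    the vertices at distance two considered here differ because their common
    neighbor has degree 2.  So a1, a2 and a3 exhaust the three colors, and w
    differs from each: from a1 as a neighbor, from a2 through a1, and from a3
    through a4. *)
Lemma pentagon_excludes (G : sgraph) (phi : G -> color) (w a1 a2 a3 a4 : G) m :
  proper_conflict_free phi ->
  neighborhood a1 = [set w; a2]%SET -> neighborhood a2 = [set a1; a3]%SET ->
  neighborhood a4 = [set a3; w]%SET ->
  w != a2 -> a1 != a3 -> a3 != w ->
  color_range m 3 (phi a1) -> color_range m 3 (phi a2) ->
  color_range m 3 (phi a3) -> ~ color_range m 3 (phi w).
Proof.
move=> pcf N1 N2 N4 wa2 a13 a3w.
have proper x y : y \in neighborhood x -> phi x != phi y.
  by rewrite inE; apply: pcf.1.
have := conflict_free_deg2 pcf N1 wa2.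
have := conflict_free_deg2 pcf N2 a13.
have := conflict_free_deg2 pcf N4 a3w.
have := proper a1 w; rewrite N1 !inE eqxx => /(_ isT).
have := proper a1 a2; rewrite N1 !inE eqxx orbT => /(_ isT).
have := proper a2 a3; rewrite N2 !inE eqxx orbT => /(_ isT).
rewrite -!(inj_eq val_inj) /color_range /=; lia.
Qed.

Section NotChoosable.
Variables (H : sgraph) (v : H).

Let w (i : 'I_9) : attach v := inr i.

Lemma rim_neighborhood (i a b : 'I_9) : i != knot ->
  (forall j : 'I_9, bowtie i j = (j == a) || (j == b)) ->
  neighborhood (w i) = [set w a; w b]%SET.
Proof.
move=> /negbTE ik E; apply/setP => -[x|j]; rewrite !inE /=.
  by rewrite ik andbF.
by rewrite E.
Qed.

Lemma knot_degree : (degree (w knot) <= 5)%N.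
Proof.
pose s : seq (attach v) := inl v ::
  [:: w (inord 0); w (inord 3); w (inord 5); w (inord 8)].
apply: (@leq_trans #|s|); last exact: card_size.
apply/subset_leq_card/fintype.subsetP => -[x|j]; rewrite !inE /=.
  by rewrite andbT => /eqP ->; rewrite eqxx.
have eqw k : (inr j == w k) = (j == k) by [].
by rewrite !eqw -!val_eqE /= !inordK // /bowtie !inE !xpair_eqE /=; lia.
Qed.

Definition bad_lists (x : attach v) : set color :=
  match x with
  | inl _ => setT
  | inr i => if i == knot then color_range 0 6
             else color_range (if (i < 4)%N then 0 else 3) 3
  end.

Lemma attach_not_choosable : ~ pcf_degree_choosable (attach v) 1.
Proof.
pose o k := @inord 8 k.
have ok k : (k < 9)%N -> o k = k :> nat by exact: inordK.
have N i a b : [&& i < 9, a < 9, b < 9, i != 4 & all (fun j =>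
      bowtie i j == (j == a) || (j == b)) (iota 0 9)]%N ->
    neighborhood (w (o i)) = [set w (o a); w (o b)]%SET.
  move=> /and5P [i9 a9 b9 i4 /allP E]; apply: rim_neighborhood.
    by rewrite -val_eqE /= ok.
  move=> j; rewrite -!val_eqE /= !ok //; apply/eqP/E.
  by rewrite mem_iota ltn_ord.
have wneq i j : [&& i < 9, j < 9 & i != j]%N -> w (o i) != w (o j).
  move=> /and3P [i9 j9]; apply: contraNneq => -[] /(congr1 val) /=.
  by rewrite !ok // => ->.
have knE : knot = o 4 by apply: val_inj; rewrite /= ok.
move=> /(_ bad_lists) [|phi [pcf col]].
  move=> [x|i] /=.
    by apply: card_le_trans (color_range_card 0 _) _; exact: card_leT.
  case: ifPn => [/eqP ->|ik].
    apply: card_le_trans (color_range_card 0 6).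
    by rewrite card_le_II -[6%N]/(5 + 1)%N leq_add2r; exact: knot_degree.
  apply: card_le_trans (color_range_card _ 3); rewrite card_le_II.
  suff [a [b E]] : exists a b, neighborhood (w i) = [set a; b]%SET.
    by rewrite /degree -/(w i) E cards2; case: eqP.
  move: ik; rewrite -val_eqE /= => ik.
  have -> : i = o i by apply: val_inj; rewrite /= ok.
  case: i ik => [[|[|[|[|[|[|[|[|[|j]]]]]]]]] lj] //= _; do 2!eexists.
  - exact: (N 0 4 1).
  - exact: (N 1 0 2).
  - exact: (N 2 1 3).
  - exact: (N 3 2 4).
  - exact: (N 5 4 6).
  - exact: (N 6 5 7).
  - exact: (N 7 6 8).
  - exact: (N 8 7 4).
have colw i : (i < 9)%N -> i != 4 ->
    color_range (if (i < 4)%N then 0 else 3) 3 (phi (w (o i))).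
  by move=> i9 /negbTE i4; have := col (w (o i)); rewrite /= -val_eqE /= ok // i4.
have colk : color_range 0 6 (phi (w (o 4))).
  by have := col (w (o 4)); rewrite /= knE eqxx.
have low := @pentagon_excludes _ _ (w (o 4)) (w (o 0)) (w (o 1)) (w (o 2))
  (w (o 3)) 0 pcf (N 0 4 1 isT) (N 1 0 2 isT) (N 3 2 4 isT)
  (wneq 4 1 isT) (wneq 0 2 isT) (wneq 2 4 isT)
  (colw 0 isT isT) (colw 1 isT isT) (colw 2 isT isT).
have high := @pentagon_excludes _ _ (w (o 4)) (w (o 5)) (w (o 6)) (w (o 7))
  (w (o 8)) 3 pcf (N 5 4 6 isT) (N 6 5 7 isT) (N 8 7 4 isT)
  (wneq 4 6 isT) (wneq 5 7 isT) (wneq 7 4 isT)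
  (colw 5 isT isT) (colw 6 isT isT) (colw 7 isT isT).
move: colk low high; rewrite /color_range /=; lia.
Qed.

End NotChoosable.

(** * Segments, components and rays *)

Section Segments.
Variable R : realType.
Notation plane := (R * R)%type.
Implicit Types (a b p q x y z : plane).

Lemma segmentP a b z : segment a b z <->
  exists2 t : R, 0 <= t <= 1 & z = (1 - t) *: a + t *: b.
Proof.
split; last by move=> [t t01 ->]; exists t; rewrite //= in_itv.
by move=> [t /=]; rewrite in_itv /= => t01 <-; exists t.
Qed.

Lemma segment_left a b : segment a b a.
Proof.
by apply/segmentP; exists 0; rewrite ?lexx ?ler01 // subr0 scale1r scale0r addr0.
Qed.

Lemma segment_right a b : segment a b b.
Proof.
by apply/segmentP; exists 1; rewrite ?lexx ?ler01 // subrr scale1r scale0r add0r.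
Qed.

Lemma segmentC a b : segment a b = segment b a.
Proof.
suff H x y : segment x y `<=` segment y x by apply/seteqP; split; exact: H.
move=> z /segmentP [t t01 ->]; apply/segmentP; exists (1 - t); first by lra.
by rewrite subKr addrC.
Qed.

Lemma segmentxx a : segment a a = [set a].
Proof.
apply/seteqP; split => z; last by move=> ->; exact: segment_left.
by move=> /segmentP [t _ ->]; rewrite -scalerDl subrK scale1r.
Qed.

Lemma segment_path_continuous a b :
  continuous (fun t : R => (1 - t) *: a + t *: b).
Proof.
move=> t; apply: cvgD; apply: cvgZl; last exact: cvg_id.
by apply: cvgB; [exact: cvg_cst|exact: cvg_id].
Qed.

Lemma segment_closed a b : closed (segment a b).
Proof.
apply: compact_closed; first exact: norm_hausdorff.
apply: continuous_compact; last exact: segment_compact.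
exact/continuous_subspaceT/segment_path_continuous.
Qed.

Lemma segment_conn a b : connected (segment a b).
Proof.
apply: connected_continuous_connected; first exact: segment_connected.
exact/continuous_subspaceT/segment_path_continuous.
Qed.

Lemma segment_component (A : set plane) a b :
  segment a b `<=` A -> connected_component A a b.
Proof.
move=> sA; apply: (connected_component_max (segment_left a b) sA).
  exact: segment_conn.
exact: segment_right.
Qed.

Lemma segment_polygonal a b : a <> b -> polygonal_arc a b (segment a b).
Proof.
move=> ab; split; last first.
  by exists [:: (a, b)]; rewrite set_cons1 bigcup_set1.
exists (fun t : R => (1 - t) *: a + t *: b); split.
- exact/continuous_subspaceT/segment_path_continuous.
- move=> s t _ _ st; apply/eqP; rewrite -subr_eq0; apply/negPn/negP => st0.
  apply: ab; apply/eqP; rewrite eq_sym -subr_eq0.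
  have : (s - t) *: (b - a) == 0.
    rewrite (_ : _ *: _ = ((1 - s) *: a + s *: b) - ((1 - t) *: a + t *: b)).
      by rewrite st subrr.
    by case: a b {st} => [a1 a2] [b1 b2]; congr pair;
    rewrite /= /GRing.scale /=; ring.
  by rewrite scaler_eq0 (negbTE st0).
- by rewrite subr0 scale1r scale0r addr0.
- by rewrite subrr scale1r scale0r add0r.
- by [].
Qed.

Lemma ball_segment c x z (e : R) : ball c e x -> segment c x z -> ball c e z.
Proof.
rewrite -!ball_normE /= => cx /segmentP [t t01 ->].
rewrite (_ : c - _ = t *: (c - x)); last first.
  by case: c x {cx} => [c1 c2] [x1 x2]; congr pair;
    rewrite /= /GRing.scale /=; ring.
rewrite normrZ ger0_norm; last by lra.
have := normr_ge0 (c - x); nra.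
Qed.

(** Balls are star-shaped, hence connected. *)
Lemma component_open (A : set plane) x : open A -> open (connected_component A x).
Proof.
move=> Ao; rewrite openE => y xy.
have /Ao /nbhs_ballP [e /= e0 eA] := connected_component_sub xy.
apply/nbhs_ballP; exists e => //= z yz; apply: (connected_component_trans xy).
by apply: segment_component => u /(ball_segment yz); apply: eA.
Qed.

(** Seen from p, the set A has no end between p and x: a point of A on the
    half-open segment from p to x forces x into A. *)
Definition ray_closed p (A : set plane) x : Prop :=
  forall t : R, 0 < t <= 1 -> A ((1 - t) *: p + t *: x) -> A x.

(** The distance from r to the ends of the unit interval, not counting an end
    that r is equal to. *)
Definition end_gap (r : R) : R :=
  Num.min (if r == 0 then 1 else r) (if r == 1 then 1 else 1 - r).

Lemma end_gap_gt0 (r : R) : 0 <= r <= 1 -> 0 < end_gap r.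
Proof.
move=> r01; rewrite /end_gap lt_min.
by case: eqVneq => r0; case: eqVneq => r1; apply/andP; split; lra.
Qed.

(** If r is an end of the interval, moving from r towards q cannot leave through
    that end however large the factor 1/t is; the other end is kept out of reach
    by the bound on the displacement. *)
Lemma end_gapP (r q t : R) : 0 <= r <= 1 -> 0 <= q <= 1 -> 0 < t <= 1 ->
  `|(q - r) / t| < end_gap r -> 0 <= r + (q - r) / t <= 1.
Proof.
move=> r01 q01 t01; set m := (q - r) / t.
have tV : 0 < t^-1 by rewrite invr_gt0; lra.
rewrite /end_gap lt_min !ltr_norml => /andP [/andP [m1 m2] /andP [m3 m4]].
apply/andP; split.
  move: m1; case: eqVneq => [r0 _|]; last by lra.
  by rewrite r0 add0r /m r0 subr0 mulr_ge0 //; lra.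
move: m4; case: eqVneq => [r1 _|]; last by lra.
have : 0 <= (r - q) / t by rewrite mulr_ge0 //; lra.
by rewrite -opprB mulNr -/m; lra.
Qed.

(** Away from the segment there is nothing to show.  If p lies on it, a ray from
    p that runs along the segment stays in it until an endpoint other than p,
    that is, at least for a fixed positive length. *)
Lemma segment_ray_closed p a b : \forall x \near p, ray_closed p (segment a b) x.
Proof.
have [/segmentP [r r01 pE]|np] := pselect (segment a b p); last first.
  have /nbhs_ballP [e /= e0 eA] : nbhs p (~` segment a b).
    by apply: open_nbhs_nbhs; split => //; exact/closed_openC/segment_closed.
  apply/nbhs_ballP; exists e => //= x px t t01 st; exfalso.
  apply: (eA _ _ st); apply: ball_segment px _; apply/segmentP; exists t => //; lra.
have [ab|ab] := eqVneq a b.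
  apply: (@filterE _ (nbhs p)) => x t t01; rewrite ab segmentxx => /= ptx.
  have {}pE : p = b by rewrite pE ab -scalerDl subrK scale1r.
  have : t *: (x - b) = 0.
    rewrite -(subrr b) -{2}ptx pE.
    by case: b {ab pE ptx} x => [c1 c2] [x1 x2]; congr pair;
    rewrite /= /GRing.scale /=; ring.
  move=> /eqP; rewrite scaler_eq0 subr_eq0 => /orP [/eqP t0|/eqP //].
  by move: t01; rewrite t0 ltxx.
have d0 : 0 < `|b - a| by rewrite normr_gt0 subr_eq0 eq_sym.
apply/nbhs_ballP; exists (`|b - a| * end_gap r) => /=.
  by rewrite mulr_gt0 // end_gap_gt0.
move=> x; rewrite -ball_normE /= => px t t01 /segmentP [q q01 E].
have t0 : t != 0 by case/andP: t01 => /lt0r_neq0.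
pose m := (q - r) / t.
have xE : x = (1 - (r + m)) *: a + (r + m) *: b.
  apply: (scalerI t0).
  have -> : t *: x = ((1 - q) *: a + q *: b) - (1 - t) *: p.
    by rewrite -E addrC addKr.
  rewrite pE /m.
  by case: a b {pE ab d0 E px} => [a1 a2] [b1 b2]; congr pair;
    rewrite /= /GRing.scale /=; field.
rewrite xE; apply/segmentP; exists (r + m) => //; apply: end_gapP => //.
move: px; rewrite (_ : p - x = - m *: (b - a)); last first.
  rewrite xE pE.
  by case: a b {pE ab d0 E xE} => [a1 a2] [b1 b2]; congr pair;
    rewrite /= /GRing.scale /=; ring.
by rewrite normrZ normrN mulrC ltr_pM2l.
Qed.

End Segments.

(** * Drawings near a point *)

Section Drawings.
Variables (R : realType) (G : sgraph).
Notation plane := (R * R)%type.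
Variables (pos : G -> plane) (arc : G -> G -> set plane).
Hypothesis emb : planar_embedding pos arc.

Lemma arc_segments u v : adj u v -> exists s : seq (plane * plane),
  arc u v = \bigcup_(ab in [set` s]) segment ab.1 ab.2.
Proof. by case: emb => _ A _ _ /A [_ []]. Qed.

Lemma arc_closed u v : adj u v -> closed (arc u v).
Proof.
move=> /arc_segments [s ->]; apply: closed_bigcup => [|ab _]; first exact: finite_seq.
exact: segment_closed.
Qed.

Lemma drawing_closed : closed (drawing pos arc).
Proof.
apply: closedU.
  rewrite (_ : range pos = \bigcup_(u in [set: G]) [set pos u]).
    apply: closed_bigcup => [|u _]; first exact: finite_finset.
    by rewrite -segmentxx; exact: segment_closed.
  apply/seteqP; split=> [_ [u _ <-]|z [u _ ->]]; last by exists u.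
  by exists u.
apply: closed_bigcup => [|e /=]; first exact: finite_finset.
exact: arc_closed.
Qed.

Lemma drawing_ray_closed p : \forall x \near p, ray_closed p (drawing pos arc) x.
Proof.
have Hpos : \forall x \near p, forall u, ray_closed p [set pos u] x.
  apply: (@filter_forall _ _ (fun u => ray_closed p [set pos u]) (nbhs p)) => u.
  rewrite -segmentxx; exact: segment_ray_closed.
have Harc : \forall x \near p, forall e : G * G, adj e.1 e.2 ->
    ray_closed p (arc e.1 e.2) x.
  apply: (@filter_forall _ _ (fun (e : G * G) x => adj e.1 e.2 ->
    ray_closed p (arc e.1 e.2) x) (nbhs p)) => -[u v] /=.
  have [uv|nuv] := boolP (adj u v); last exact: (@filterE _ (nbhs p)).
  have [s ->] := arc_segments uv.
  have Hs : \forall x \near p, forall ab, ab \in s ->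
      ray_closed p (segment ab.1 ab.2) x.
    elim: s => [|ab s IH]; first exact: (@filterE _ (nbhs p)).
    apply: filterS2 (segment_ray_closed p ab.1 ab.2) IH => x Hx IHx cd.
    by rewrite inE => /orP [/eqP ->|/IHx].
  apply: filterS Hs => x Hx _ t t01 [ab abs pt].
  by exists ab => //; exact: Hx pt.
apply: filterS2 Hpos Harc => x Hx Ex t t01 [[u _ pt]|[e uv pt]].
  by left; exists u => //; apply/esym/(Hx u t t01); rewrite /= pt.
by right; exists e => //; exact: (Ex e uv t t01).
Qed.

End Drawings.

(** * Affine charts at a vertex *)

Section Chart.
Variable R : realType.
Notation plane := (R * R)%type.
Variables (p u : plane) (c : R).

(** The second coordinate runs from p along u; the first is perpendicular to u
    and shrunk by c, which makes the image of the wedge as thin as desired. *)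
Definition chart (q : plane) : plane :=
  p + q.2 *: u + (q.1 * c) *: ((- u.2, u.1) : plane).

Definition unchart (z : plane) : plane :=
  let d := u.1 ^+ 2 + u.2 ^+ 2 in
  (((z.2 - p.2) * u.1 - (z.1 - p.1) * u.2) / (c * d),
   ((z.1 - p.1) * u.1 + (z.2 - p.2) * u.2) / d).

Lemma chart0 : chart 0 = p.
Proof. by rewrite /chart /= mul0r !scale0r !addr0. Qed.

Lemma chart_combine (a b : plane) t :
  chart ((1 - t) *: a + t *: b) = (1 - t) *: chart a + t *: chart b.
Proof.
rewrite /chart; case: p u a b => [p1 p2] [u1 u2] [a1 a2] [b1 b2].
by congr pair;
    rewrite /= /GRing.scale /=; ring.
Qed.

Lemma chart_segment (a b : plane) :
  segment (chart a) (chart b) = chart @` segment a b.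
Proof.
apply/seteqP; split=> [z /segmentP [t t01 ->]|_ [_ /segmentP [t t01 ->] <-]].
  exists ((1 - t) *: a + t *: b); last exact: chart_combine.
  by apply/segmentP; exists t.
by apply/segmentP; exists t => //; exact: chart_combine.
Qed.

Lemma chart_norm (q : plane) :
  `|chart q| <= `|p| + `|q.2| * `|u| + `|q.1| * `|c| * `|u|.
Proof.
have uE : `|((- u.2, u.1) : plane)| = `|u|.
  by rewrite !prod_normE /= normrN maxC.
rewrite /chart; apply: le_trans (ler_normD _ _) _; apply: lerD.
  by apply: le_trans (ler_normD _ _) _; rewrite normrZ.
by rewrite normrZ uE normrM.
Qed.

Lemma chart_continuous : continuous chart.
Proof.
move=> q; apply: cvgD; first apply: cvgD; first exact: cvg_cst.
  by apply: cvgZl; exact: cvg_snd.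
by apply: cvgZl; apply: cvgMl; exact: cvg_fst.
Qed.

Lemma unchart_continuous : continuous unchart.
Proof.
move=> z.
have c1 : (fun z : plane => z.1 - p.1) z @[z --> z] --> z.1 - p.1.
  by apply: cvgB; [exact: cvg_fst|exact: cvg_cst].
have c2 : (fun z : plane => z.2 - p.2) z @[z --> z] --> z.2 - p.2.
  by apply: cvgB; [exact: cvg_snd|exact: cvg_cst].
apply: (@cvg_pair _ _ _ (nbhs z) (nbhs (unchart z).1) (nbhs (unchart z).2) _ _ _
  (fun z => (unchart z).1) (fun z => (unchart z).2)); apply: cvgMl.
  by apply: cvgB; apply: cvgMl.
by apply: cvgD; apply: cvgMl.
Qed.

Hypotheses (u0 : u != 0) (c0 : c != 0).

Lemma chart_discr : u.1 ^+ 2 + u.2 ^+ 2 != 0.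
Proof.
apply: contra u0 => H; rewrite (surjective_pairing u).
move: H; rewrite paddr_eq0 ?sqr_ge0 // !sqrf_eq0 => /andP [/eqP -> /eqP ->].
by [].
Qed.

Lemma chartK : cancel chart unchart.
Proof.
move: chart_discr; rewrite /chart /unchart;
case: p u => [p1 p2] [u1 u2] /= d0 [a b] /=.
congr pair; rewrite /= /GRing.scale /=.
  by apply: (canLR (mulfK _)); [rewrite mulf_neq0|ring].
by apply: (canLR (mulfK _)); [|ring].
Qed.

Lemma unchartK : cancel unchart chart.
Proof.
move: chart_discr; rewrite /chart /unchart;
case: p u => [p1 p2] [u1 u2] /= d0 [a b] /=.
by congr pair; rewrite /= /GRing.scale /=; field; rewrite c0 d0.
Qed.

End Chart.

(** * The wedge and the cap *)

Section Wedge.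
Variable R : realType.
Notation plane := (R * R)%type.
Implicit Types p q x y z : plane.

(** The constants leave room for nine points on the parabola with first
    coordinates -4, ..., 4: the lowest of them have height 4, so they are in the
    cone of slope one, which lies inside the wider cone of the wedge; the top of
    the parabola has height 20, below the top of the wedge. *)
Definition wedge : set plane := [set q | 0 < q.2 < 21 /\ `|q.1| < 2 * q.2].
Definition cap : set plane :=
  [set q | `|q.1| <= q.2 /\ q.2 <= 20 - q.1 ^+ 2].

Lemma lerp_lerp p y (s t : R) :
  (1 - t) *: y + t *: ((1 - s) *: p + s *: y) =
  (1 - (1 - t + t * s)) *: p + (1 - t + t * s) *: y.
Proof.
case: p y => [p1 p2] [y1 y2].
by congr pair;
    rewrite /= /GRing.scale /=; ring.
Qed.

(** A vertex on the boundary of a face is accessible from it through a whole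
    wedge: F contains a ball around a point x near p, and by [ray_closed] no
    half-open segment from p to a point y of the ball meets D.  Such a segment
    then lies in the component of y, which is F.  The factor c is chosen so that
    the points of the chart at height 21 fill no more than that ball. *)
Lemma wedge_chart (D : set plane) p x0 :
  closed D -> D p -> (\forall x \near p, ray_closed p D x) ->
  closure (connected_component (~` D) x0) p ->
  exists u c, [/\ u != 0, c != 0 &
    forall q, wedge q -> connected_component (~` D) x0 (chart p u c q)].
Proof.
set F := connected_component _ _ => Dcl Dp Dray Fp.
have Fo : open F by apply: component_open; exact: closed_openC.
have FD : F `<=` ~` D by exact: connected_component_sub.
have [x [Fx]] := Fp _ (nbhs_interior Dray); rewrite /interior /= => xray.
have /nbhs_ballP [d /= d0 dF] : nbhs x [set y | F y /\ ray_closed p D y].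
  by apply: filterI xray; exact: open_nbhs_nbhs.
have xp : x - p != 0.
  by rewrite subr_eq0; apply: contraPneq Fx => -> /FD.
have u0 : 0 < `|21^-1 *: (x - p)|
  by rewrite normr_gt0 scaler_eq0 negb_or xp invr_eq0 pnatr_eq0.
set u := 21^-1 *: (x - p) in u0.
have [c c0 dE] : exists2 c, 0 < c & d = 42 * (c * `|u|).
  exists (d / (42 * `|u|)); first by rewrite divr_gt0 // mulr_gt0.
  by field; rewrite lt0r_neq0.
exists u, c; split; [by rewrite -normr_gt0|exact: lt0r_neq0|].
move=> q [/andP [q0 q21] qs].
pose y := chart p u c (21 * q.1 / q.2, 21).
have dy : ball x d y.
  have -> : x = chart p u c (0, 21).
    rewrite /chart /u /= mul0r scale0r addr0 scalerA mulfV ?pnatr_eq0 //.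
    by rewrite scale1r addrC subrK.
  rewrite -ball_normE /= /y /chart /= mul0r scale0r addr0.
  rewrite opprD addrA subrr add0r normrN normrZ !normrM.
  have -> : `|(- u.2, u.1) : plane| = `|u|.
    by rewrite !prod_normE /= normrN maxC.
  rewrite dE (gtr0_norm c0) [in ltRHS]mulrA -!mulrA !mulrA !ltr_pM2r //.
  rewrite normfV (gtr0_norm q0) ltr_pdivrMr // ger0_norm //; lra.
have [Fy yray] := dF _ dy.
have on_ray (t : R) : 0 < t <= 1 -> ~ D ((1 - t) *: p + t *: y).
  by move=> t01 /(yray _ t01); exact: FD.
have -> : chart p u c q = (1 - q.2 / 21) *: p + (q.2 / 21) *: y.
  rewrite -{2}(chart0 p u c) -chart_combine; congr chart.
  case: q q0 {q21 qs dy y Fy yray on_ray} => q1 q2 /= q0.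
  by congr pair; rewrite /= /GRing.scale /=; field; rewrite ?lt0r_neq0.
apply: (connected_component_trans Fy); apply: segment_component => z.
move=> /segmentP [t t01 ->].
rewrite lerp_lerp; apply: on_ray.
have s0 : 0 < q.2 / 21 by rewrite divr_gt0.
have s1 : q.2 / 21 <= 1 by rewrite ler_pdivrMr // mul1r ltW.
apply/andP; split; nra.
Qed.

Lemma cap0 : cap 0.
Proof. by rewrite /cap /= normr0 expr0n /=; split; lra. Qed.

Lemma cap_wedge q : cap q -> q != 0 -> wedge q.
Proof.
case: q => q1 q2; rewrite /cap /wedge /= => -[c1 c2] q0.
have n0 := normr_ge0 q1; have s0 := sqr_ge0 q1.
suff : q2 != 0.
  move=> q20; have : 0 < q2 by rewrite lt_neqAle eq_sym q20 /=; lra.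
  by split; lra.
apply: contraNneq q0 => q20.
have -> : q1 = 0 by apply/eqP; rewrite -normr_eq0; lra.
by rewrite q20.
Qed.

(** Star-shapedness about the origin, in the form in which it is used: leaving
    the cap along a ray is final. *)
Lemma cap_star q (l : R) : 1 <= l -> cap (l *: q) -> cap q.
Proof.
case: q => q1 q2; rewrite /cap /= /GRing.scale /= normrM => l1.
have l0 : 0 < l by lra.
rewrite gtr0_norm // ler_pM2l // exprMn => -[c1 c2]; split => //.
have n0 := normr_ge0 q1.
have : q2 <= l * q2 by apply: ler_peMl => //; lra.
have : q1 ^+ 2 <= l ^+ 2 * q1 ^+ 2 by apply: ler_peMl; rewrite ?sqr_ge0 ?exprn_ege1.
lra.
Qed.

Lemma closed_nonneg (f : plane -> R) : continuous f -> closed [set q | 0 <= f q].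
Proof.
move=> fc; apply: (@preimage_closed _ _ f [set t | 0 <= t]); last exact: closed_ge.
by move=> q _; exact: fc.
Qed.

Lemma open_pos (f : plane -> R) : continuous f -> open [set q | 0 < f q].
Proof.
move=> fc; apply: (@open_comp _ _ f [set t | 0 < t]); last exact: open_gt.
by move=> q _; exact: fc.
Qed.

Lemma wedge_open : open wedge.
Proof.
rewrite (_ : wedge = [set q | 0 < q.2] `&` [set q | 0 < 21 - q.2] `&`
                     [set q | 0 < 2 * q.2 - `|q.1|]); last first.
  apply/seteqP; split=> q; rewrite /wedge /= !subr_gt0.
    by move=> [/andP [-> ->] ->].
  by move=> [[-> ->] ->].
apply: openI; first apply: openI; apply: open_pos => q.
- exact: cvg_snd.
- by apply: cvgB; [exact: cvg_cst|exact: cvg_snd].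
- apply: cvgB; first by apply: cvgMr; exact: cvg_snd.
  by apply: cvg_norm; exact: cvg_fst.
Qed.

Lemma cap_closed : closed cap.
Proof.
rewrite (_ : cap = [set q | 0 <= q.2 - `|q.1|] `&`
                   [set q | 0 <= 20 - q.1 ^+ 2 - q.2]); last first.
  by apply/seteqP; split=> q; rewrite /cap /= !subr_ge0.
apply: closedI; apply: closed_nonneg => q.
  by apply: cvgB; [exact: cvg_snd|apply: cvg_norm; exact: cvg_fst].
apply: cvgB; last exact: cvg_snd.
by apply: cvgB; [exact: cvg_cst|apply: cvgM; exact: cvg_fst].
Qed.

Lemma wedge_convex (a b : plane) : wedge a -> wedge b -> segment a b `<=` wedge.
Proof.
case: a b => [a1 a2] [b1 b2] /= [/= a0 a12] [/= b0 b12] z /segmentP [t t01 ->].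
rewrite /wedge /= /GRing.scale /=; split.
  have [t0|t0] := eqVneq t 0; first by rewrite t0; lra.
  apply/andP; split; nra.
have t1 : 0 <= 1 - t by lra.
have t2 : 0 <= t by lra.
apply: le_lt_trans (ler_normD _ _) _; rewrite !normrM (ger0_norm t1) (ger0_norm t2).
have [t0|t0] := eqVneq t 0; first by rewrite t0; lra.
have {}t0 : 0 < t by rewrite lt_neqAle eq_sym t0 /=; lra.
nra.
Qed.

Lemma cap_convex (a b : plane) : cap a -> cap b -> segment a b `<=` cap.
Proof.
case: a b => [a1 a2] [b1 b2] /= [/= a12 a20] [/= b12 b20] z /segmentP [t t01 ->].
rewrite /cap /= /GRing.scale /=; split.
  have t1 : 0 <= 1 - t by lra.
have t2 : 0 <= t by lra.
  apply: le_trans (ler_normD _ _) _; rewrite !normrM (ger0_norm t1) (ger0_norm t2).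
  nra.
rewrite (_ : (_ + _) ^+ 2 = (1 - t) * a1 ^+ 2 + t * b1 ^+ 2
    - t * (1 - t) * (a1 - b1) ^+ 2); last by ring.
have : 0 <= t * (1 - t) * (a1 - b1) ^+ 2 by apply: mulr_ge0; [apply: mulr_ge0; lra|exact: sqr_ge0].
nra.
Qed.

(** The cap is thinner than the wedge at the origin, so the apex can be
    approached along the line s = 3t/2 between the two. *)
Lemma wedgeDcap_closure0 : closure (wedge `\` cap) 0.
Proof.
move=> U /nbhs_ballP [e /= e0 eU].
pose t := Num.min (e / 2) 1.
have t0 : 0 < t by rewrite /t lt_min ltr01 divr_gt0.
have te : t <= e / 2 by rewrite /t ge_min lexx.
have t1 : t <= 1 by rewrite /t ge_min lexx orbT.
exists ((3 / 2 * t, t) : plane); split.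
  split; first by rewrite /wedge /= gtr0_norm; [split; lra|lra].
  by rewrite /cap /= gtr0_norm => [[]|]; lra.
apply: eU; rewrite -ball_normE /= sub0r normrN prod_normE /= gt_max.
by rewrite !gtr0_norm; lra.
Qed.

Definition parabola (x : R) : plane := (x, 20 - x ^+ 2).

Lemma parabola_cap (x : R) : `|x| <= 4 -> cap (parabola x).
Proof.
rewrite /cap /parabola /= => x4; split => //.
have := normr_ge0 x; rewrite -(real_normK (num_real x)); nra.
Qed.

(** Points of the parabola are approached from straight above. *)
Lemma wedgeDcap_closure_parabola (x : R) : `|x| <= 4 ->
  closure (wedge `\` cap) (parabola x).
Proof.
move=> x4 U /nbhs_ballP [e /= e0 eU].
pose t := Num.min (e / 2) (1 / 2).
have t0 : 0 < t by rewrite /t lt_min !divr_gt0 //; lra.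
have te : t <= e / 2 by rewrite /t ge_min lexx.
have t1 : t <= 1 / 2 by rewrite /t ge_min lexx orbT.
have n0 := normr_ge0 x; have s0 := sqr_ge0 x; have sx := real_normK (num_real x).
exists ((x, 20 - x ^+ 2 + t) : plane); split.
  split; first by rewrite /wedge /=; split; [apply/andP; split|]; nra.
  by rewrite /cap /= => -[]; lra.
apply: eU; rewrite -ball_normE /= prod_normE /= subrr normr0 gt_max e0 /=.
by rewrite opprD addrA subrr add0r normrN gtr0_norm //; lra.
Qed.

End Wedge.

(** * The face survives the insertion of the cap *)

Section Survival.
Variable R : realType.
Notation plane := (R * R)%type.
Variables (D D' : set plane) (x0 p u : plane) (c : R).
Notation F := (connected_component (~` D) x0).
Notation Phi := (chart p u c).
Hypotheses (Dcl : closed D) (Dp : D p) (u0 : u != 0) (c0 : c != 0).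
Hypothesis wedgeF : forall q, wedge q -> F (Phi q).
Hypothesis D'D : D' `<=` D `|` Phi @` @cap R.

(** The component of a point of the wedge that is above the parabola. *)
Definition new_face : set plane := connected_component (~` D') (Phi (0, 41 / 2)).

Let Phi_inj : injective Phi := can_inj (chartK p u0 c0).

Lemma cap_outside (z : plane) : F z -> ~ (Phi @` @cap R) z -> ~ D' z.
Proof. by move=> /connected_component_sub Dz Kz /D'D []. Qed.

Lemma fringe_outside q : (@wedge R `\` @cap R) q -> (~` D') (Phi q).
Proof.
move=> [wq cq]; apply: cap_outside; first exact: wedgeF.
by move=> [q' cq' /Phi_inj qq']; apply: cq; rewrite -qq'.
Qed.

Lemma fringe_link a b : segment a b `<=` @wedge R `\` @cap R ->
  connected_component (~` D') (Phi a) (Phi b).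
Proof.
move=> ab; apply: segment_component; rewrite chart_segment => _ [q /ab qE <-].
exact: fringe_outside.
Qed.

(** A point below the height 41/2 first moves outwards along its ray up to that
    height, staying outside the cap by [cap_star], and then horizontally to the
    base point of the new face.  A higher point moves straight to the base point.
    All points higher than 20 are above the whole cap. *)
Lemma fringe_new_face q : (@wedge R `\` @cap R) q -> new_face (Phi q).
Proof.
move=> [wq cq]; rewrite /new_face; apply: connected_component_sym.
have topw : wedge (0 : R, 41 / 2 : R) by rewrite /wedge /= normr0; split; lra.
have [high|low] := leP (41 / 2) q.2.
  apply: fringe_link => z qz; split; first exact: wedge_convex wq topw _ qz.
  move: qz => /segmentP [t t01 ->]; rewrite /cap /= /GRing.scale /= => -[_].
  set s := _ ^+ 2; have : 0 <= s by exact: sqr_ge0.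
  nra.
have q0 : 0 < q.2 by case: wq => /andP [].
pose l := (41 / 2) / q.2.
have l1 : 1 <= l by rewrite /l ler_pdivlMr // mul1r ltW.
have lq : (l *: q).2 = 41 / 2 by rewrite /= /GRing.scale /l /= divfK // lt0r_neq0.
have lw : wedge (l *: q).
  split; rewrite lq; first by lra.
  rewrite -lq /= /GRing.scale /= normrM gtr0_norm; last by lra.
  by rewrite mulrCA ltr_pM2l; [case: wq|lra].
apply: (@connected_component_trans _ _ (Phi (l *: q))).
  apply: fringe_link => z qz; split; first exact: wedge_convex wq lw _ qz.
  move: qz => /segmentP [t t01 ->]; rewrite scalerA -scalerDl => /cap_star H.
  by apply/cq/H; nra.
apply: fringe_link => z qz; split; first exact: wedge_convex lw topw _ qz.
move: qz => /segmentP [t t01 ->]; rewrite /cap /= -[_ *: q.2]/((l *: q).2) lq /GRing.scale /= => -[_].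
set s := _ ^+ 2; have : 0 <= s by exact: sqr_ge0.
nra.
Qed.

(** The cap in the plane of the drawing, described through the inverse chart so
    that it is visibly closed. *)
Let capsule : set plane := unchart p u c @^-1` @cap R.

Lemma capsuleE : Phi @` @cap R = capsule.
Proof.
apply/seteqP; split=> [_ [q cq <-]|z cz]; rewrite /capsule /=.
  by rewrite chartK.
by exists (unchart p u c z) => //; exact: unchartK.
Qed.

Lemma capsule_closed : closed capsule.
Proof.
apply: preimage_closed; last exact: cap_closed.
by move=> z _; exact: unchart_continuous.
Qed.

Lemma capsule_face z : capsule z -> z <> p -> F z.
Proof.
rewrite -capsuleE => -[q cq <-] qp; apply/wedgeF/cap_wedge => //.
by apply: contraPneq qp => -> ; rewrite chart0.
Qed.

(** F is connected, so it is enough that B, the part of F in the capsule or in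
    the new face, is clopen in F.  Near a point of F outside the capsule, B is
    all or nothing, because a small ball around it avoids the new drawing.  Near
    a point of the capsule, all points of F in the wedge belong to B by
    [fringe_new_face]. *)
Lemma face_sub : F `<=` capsule `|` new_face.
Proof.
have Fo : open F by apply: component_open; exact: closed_openC.
have FD : F `<=` ~` D by exact: connected_component_sub.
have F'o z : F z -> ~ capsule z -> nbhs z (connected_component (~` D') z).
  move=> Fz cz; have : nbhs z (F `&` ~` capsule).
    apply: open_nbhs_nbhs; split => //; apply: openI => //.
    exact/closed_openC/capsule_closed.
  move=> /nbhs_ballP [e /= e0 eF]; apply/nbhs_ballP; exists e => //= y zy.
  apply: segment_component => x /(ball_segment zy) /eF [Fx cx].
  by apply: cap_outside => //; rewrite capsuleE.
have Ftop : F (Phi (0, 41 / 2)).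
  by apply: wedgeF; rewrite /wedge /= normr0; split; lra.
have top_out : ~ capsule (Phi (0, 41 / 2)).
  by rewrite /capsule /= chartK // /cap /= => -[_]; rewrite expr0n /=; lra.
pose B := F `&` (capsule `|` new_face).
suff <- : B = F by move=> z [].
apply: (@component_connected _ (~` D) x0).
- exists (Phi (0, 41 / 2)); split => //; right; apply: connected_component_refl.
  by apply: cap_outside => //; rewrite capsuleE.
- exists (B°); first exact: open_interior.
  apply/seteqP; split=> [z Bz|z [Fz /interior_subset //]]; split; first by case: Bz.
  case: Bz => Fz; have [cz _|ncz [//|F'z]] := pselect (capsule z).
    have zw : wedge (unchart p u c z).
      apply: cap_wedge => //; apply: contraPneq Fz => z0.
      by rewrite -(unchartK p u0 c0 z) z0 chart0 => /FD.
    have : nbhs z (unchart p u c @^-1` @wedge R).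
      apply: unchart_continuous; apply: open_nbhs_nbhs; split => //.
      exact: wedge_open.
    apply: (@filterS _ (nbhs z)) => y /= yw; rewrite -(unchartK p u0 c0 y).
    split; first exact: wedgeF.
    have [cy|ncy] := pselect (@cap R (unchart p u c y)).
      by left; rewrite /capsule /= chartK.
    by right; exact: fringe_new_face.
  apply: filterS (filterI (open_nbhs_nbhs (conj Fo Fz)) (F'o z Fz ncz)).
  move=> y [Fy zy]; split => //; right; exact: connected_component_trans F'z zy.
- exists (~` ((F `&` ~` capsule `&` ~` new_face)°)).
    by apply: open_closedC; exact: open_interior.
  apply/seteqP; split=> [z [Fz Bz]|z [Fz H]]; split => //.
    by move=> /interior_subset [[_ ?] ?]; case: Bz.
  apply: contrapT => nB; apply: H.
  have cz : ~ capsule z by move=> ?; apply: nB; left.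
  have F'z : ~ new_face z by move=> ?; apply: nB; right.
  have := F'o z Fz cz.
  have cn : nbhs z (F `&` ~` capsule).
    apply: open_nbhs_nbhs; split => //; apply: openI => //.
    exact/closed_openC/capsule_closed.
  apply: filterS2 cn => y Fcy zy; split => // F'y; apply: F'z.
  exact: connected_component_trans F'y (connected_component_sym zy).
Qed.

Lemma new_face_unbounded : ~ bounded_set F -> ~ bounded_set new_face.
Proof.
apply: contra_not => -[M1 [_ M1P]].
pose M0 := `|p| + 20 * `|u| + 20 * `|c| * `|u|.
exists (Num.max M0 M1); split; first exact: num_real.
move=> M; rewrite gt_max => /andP [M0M M1M] z /face_sub [cz|F'z]; last exact: M1P.
apply: le_trans (ltW M0M); rewrite -(unchartK p u0 c0 z).
apply: le_trans (chart_norm _ _ _ _) _.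
have {}cz : @cap R (unchart p u c z) by [].
move: (unchart p u c z) cz => q [q1 q2].
have n0 := normr_ge0 q.1; have s0 := sqr_ge0 q.1.
rewrite (ger0_norm (le_trans n0 q1)) /M0 -!addrA lerD2l.
apply: lerD; first by apply: ler_wpM2r => //; lra.
by do 2![apply: ler_wpM2r => //]; lra.
Qed.

(** The capsule is closed and meets D in p only, so it stays away from z. *)
Lemma closure_old z : D z -> z <> p -> closure F z -> closure new_face z.
Proof.
move=> Dz zp Fz U zU.
have cz : ~ capsule z by move=> /capsule_face /(_ zp) /connected_component_sub.
have [y [Fy [Uy cy]]] : F `&` (U `&` ~` capsule) !=set0.
  apply: Fz; apply: filterI => //; apply: open_nbhs_nbhs; split => //.
  exact/closed_openC/capsule_closed.
by exists y; split => //; have [] := face_sub Fy.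
Qed.

Lemma closure_fringe q :
  closure (@wedge R `\` @cap R) q -> closure new_face (Phi q).
Proof.
move=> wq U /chart_continuous /wq [q' [wq' Uq']].
by exists (Phi q'); split => //; exact: fringe_new_face.
Qed.

Lemma new_face_boundary z :
  D' z -> closure new_face z -> boundary new_face z.
Proof.
move=> D'z cz; split => // /interior_subset /connected_component_sub.
exact.
Qed.

End Survival.

(** * The gadget is drawn without crossings *)

Section Chords.
Variables (R : realType) (H : sgraph) (v : H).
Notation plane := (R * R)%type.
Implicit Types x y z : attach v.

Definition abscissa (i : nat) : R := i%:R - 4.

Lemma abscissa_bound (i : 'I_9) : `|abscissa i| <= 4.
Proof.
rewrite /abscissa ler_norml; case: i => i /= i9.
have i8 : i%:R <= 8 :> R by rewrite ler_nat.
have := ler0n R i; lra.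
Qed.

Lemma bowtie_same_side (i j : nat) : bowtie i j -> 0 <= abscissa i * abscissa j.
Proof.
move=> ij; have [[i4 j4]|[i4 j4]] : (i <= 4 /\ j <= 4 \/ 4 <= i /\ 4 <= j)%N.
- by move: ij; rewrite /bowtie !inE !xpair_eqE; lia.
- by rewrite mulr_le0 // subr_le0 ler_nat.
- by rewrite mulr_ge0 // subr_ge0 ler_nat.
Qed.

(** For vertices in convex position, chords ij and kl do not cross when k
    and l are both weakly between i and j or both weakly outside; the sign of
    (k - i)(k - j) tells which. *)
Lemma bowtie_noncrossing (i j k l : 'I_9) : bowtie i j -> bowtie k l ->
  0 <= (abscissa k - abscissa i) * (abscissa k - abscissa j) *
       ((abscissa l - abscissa i) * (abscissa l - abscissa j)).
Proof.
have dE m n : abscissa m - abscissa n = (m%:Z - n%:Z)%:~R.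
  by rewrite /abscissa intrB !pmulrn opprB addrA subrK.
rewrite !dE -!intrM ler0z.
suff /allP chk : all (fun i => all (fun j => all (fun k => all (fun l =>
    bowtie i j ==> bowtie k l ==> (0 <= (k%:Z - i%:Z) * (k%:Z - j%:Z) *
      ((l%:Z - i%:Z) * (l%:Z - j%:Z)))) (iota 0 9)) (iota 0 9)) (iota 0 9))
    (iota 0 9).
  have io (m : 'I_9) : (m : nat) \in iota 0 9 by rewrite mem_iota ltn_ord.
  move=> ij kl; have /allP /(_ j (io j)) /allP /(_ k (io k)) := chk i (io i).
  by move=> /allP /(_ l (io l)); rewrite ij kl.
by vm_compute.
Qed.

(** The origin of the chart is the position of v; the value 0 is meaningless at
    the other vertices of H, which are excluded by [on_gadget]. *)
Definition place x : plane := if x is inr i then parabola (abscissa i) else 0.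

Lemma place_cap x : cap (place x).
Proof. by case: x => [a|i]; [exact: cap0|exact/parabola_cap/abscissa_bound]. Qed.

Definition is_old x : bool := if x is inl _ then true else false.
Definition on_gadget x : bool := if x is inl a then a == v else true.
Definition gadget_edge x y : bool := adj x y && ~~ (is_old x && is_old y).

Lemma gadget_edgeP x y : gadget_edge x y -> on_gadget x /\ on_gadget y.
Proof. by case: x y => [a|i] [b|j]; rewrite /gadget_edge /= ?andbF ?andbT // => /andP [->]. Qed.

Lemma gadget_edge_neq x y : gadget_edge x y -> x != y.
Proof. by move=> /andP [xy _]; apply: contraTneq xy => ->; rewrite adj_irr. Qed.

Definition line (l : R * R * R) (q : plane) : R :=
  l.1.1 * q.1 + l.1.2 * q.2 + l.2.

Lemma line_combine l (a b : plane) t :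
  line l ((1 - t) *: a + t *: b) = (1 - t) * line l a + t * line l b.
Proof. by rewrite /line /= /GRing.scale /=; ring. Qed.

(** An affine function that vanishes on one segment and does not change sign on
    the other, nor vanishes on all of it, can only vanish there at an end. *)
Lemma line_segments l (a b a' b' q : plane) :
  line l a = 0 -> line l b = 0 -> 0 <= line l a' * line l b' ->
  (line l a' != 0) || (line l b' != 0) ->
  segment a b q -> segment a' b' q ->
  (line l a' = 0 /\ q = a') \/ (line l b' = 0 /\ q = b').
Proof.
move=> la lb ab' nz /segmentP [s s01 qE] /segmentP [t t01 qE'].
have lq : line l q = 0 by rewrite qE line_combine la lb !mulr0 addr0.
have {lq} : (1 - t) * line l a' + t * line l b' = 0.
  by rewrite -line_combine -qE' lq.
move: (line l a') (line l b') ab' nz => f g fg nz E.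
have [f0|f0] := eqVneq f 0.
  left; split => //; rewrite f0 eqxx /= in nz; move: E.
  rewrite f0 mulr0 add0r => /eqP; rewrite mulf_eq0 (negbTE nz) orbF => /eqP t0.
  by rewrite qE' t0 subr0 scale1r scale0r addr0.
have sum0 : (1 - t) * f ^+ 2 + t * (f * g) = 0.
  by rewrite -(mulr0 f) -E; ring.
have t1 : t = 1.
  have A : 0 <= (1 - t) * f ^+ 2.
    by apply: mulr_ge0; [case/andP: t01 => _; rewrite subr_ge0|exact: sqr_ge0].
  have B : 0 <= t * (f * g) by apply: mulr_ge0 => //; case/andP: t01.
  have /eqP : (1 - t) * f ^+ 2 = 0.
    by apply/eqP; rewrite eq_le A andbT -sum0 lerDl.
  by rewrite mulf_eq0 expf_eq0 (negbTE f0) andbF orbF subr_eq0 => /eqP.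
right; split; last by rewrite qE' t1 subrr scale0r scale1r add0r.
by rewrite -E t1 subrr mul0r add0r mul1r.
Qed.

(** The line carries the edge xy, contains no other vertex of the gadget, and has
    each edge of the gadget weakly on one side. *)
Definition separates l x y : Prop :=
  [/\ line l (place x) = 0, line l (place y) = 0,
      forall z, on_gadget z -> line l (place z) = 0 -> z = x \/ z = y
    & forall x' y', gadget_edge x' y' -> 0 <= line l (place x') * line l (place y')].

Lemma separatesC l x y : separates l x y -> separates l y x.
Proof. by move=> [lx ly lz le]; split => // z nz /(lz z nz) []; [right|left]. Qed.

Lemma abscissa_knot : abscissa knot = 0.
Proof. by rewrite /abscissa /=; lra. Qed.

Lemma abscissa_inj (i j : 'I_9) : abscissa i = abscissa j -> i = j.
Proof. by move=> /(addIr _) /eqP; rewrite eqr_nat => /eqP /val_inj. Qed.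

(** The edge from v to the knot is on the axis, and each pentagon is on one side
    of it. *)
Lemma spoke_separates : separates (1, 0, 0) (inl v) (inr knot).
Proof.
have lE (q : plane) : line (1, 0, 0) q = q.1 by rewrite /line /=; ring.
split; rewrite ?lE //=; first exact: abscissa_knot.
  move=> [a|i] /=; rewrite lE /=; first by move=> /eqP ->; left.
  by rewrite -abscissa_knot => _ /abscissa_inj ->; right.
move=> [a|i] [b|j]; rewrite /gadget_edge !lE /= ?andbF ?mul0r ?mulr0 //.
by move=> /andP [/bowtie_same_side].
Qed.

(** The chord of the parabola between the abscissas a and b is on the line
    20 - t - (a + b) s + a b = 0, whose left-hand side is (x - a)(x - b) at the
    point of the parabola with abscissa x. *)
Lemma chord_separates (i j : 'I_9) : bowtie i j ->
  separates (- (abscissa i + abscissa j), -1, 20 + abscissa i * abscissa j)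
    (inr i) (inr j).
Proof.
move=> ij; have same := bowtie_same_side ij; rewrite /separates.
set l := (X in line X).
have l0 : line l 0 = 20 + abscissa i * abscissa j by rewrite /line /=; ring.
have lE (k : nat) :
    line l (parabola (abscissa k)) = (abscissa k - abscissa i) * (abscissa k - abscissa j).
  by rewrite /line /parabola /=; ring.
have lknot : 0 <= line l 0 * line l (parabola (abscissa knot)).
  by rewrite l0 lE abscissa_knot !sub0r mulrNN mulr_ge0 //; lra.
split; rewrite /= ?lE ?subrr ?mul0r ?mulr0 //.
- move=> [a|k] _ /=; first by rewrite l0 => E0; exfalso; move: E0 same; clear; lra.
  rewrite lE => /eqP; rewrite mulf_eq0 !subr_eq0.
  by move=> /orP [] /eqP /abscissa_inj ->; [left|right].
- move=> [a|k] [b|m]; rewrite /gadget_edge /= ?andbF ?andbT // => E.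
  + by case/andP: E => _ /eqP ->.
  + by case/andP: E => _ /eqP ->; rewrite mulrC.
  + by rewrite !lE; exact: bowtie_noncrossing ij E.
Qed.

Lemma separating_line x y : gadget_edge x y -> exists l, separates l x y.
Proof.
case: x y => [a|i] [b|j]; rewrite /gadget_edge /= ?andbF ?andbT //.
- by move=> /andP [/eqP -> /eqP ->]; exists (1, 0, 0); exact: spoke_separates.
- move=> /andP [/eqP -> /eqP ->]; exists (1, 0, 0).
  exact/separatesC/spoke_separates.
by move=> /chord_separates; eexists; eassumption.
Qed.

Lemma edge_avoids x y z : gadget_edge x y -> on_gadget z ->
  segment (place x) (place y) (place z) -> z = x \/ z = y.
Proof.
move=> /separating_line [l [lx ly lz _]] nz /segmentP [t _ E]; apply: lz => //.
by rewrite E line_combine lx ly !mulr0 addr0.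
Qed.

Lemma parabola_neq0 (i : 'I_9) : parabola (abscissa i) <> 0.
Proof.
move=> [_]; have := abscissa_bound i; have := real_normK (num_real (abscissa i)).
have := normr_ge0 (abscissa i); nra.
Qed.

Lemma edges_meet x y x' y' q : gadget_edge x y -> gadget_edge x' y' ->
  [set x; y]%SET != [set x'; y']%SET ->
  segment (place x) (place y) q -> segment (place x') (place y') q ->
  q = place x \/ q = place y.
Proof.
move=> xy xy' neq qs qs'; have [l [lx ly lz ln]] := separating_line xy.
have [nx' ny'] := gadget_edgeP xy'.
have nz : (line l (place x') != 0) || (line l (place y') != 0).
  rewrite -negb_and; apply: contraNN neq => /andP [/eqP x0 /eqP y0].
  have := gadget_edge_neq xy'.
  have [] := lz _ nx' x0 => ->; have [] := lz _ ny' y0 => ->; rewrite ?eqxx // => _.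
  by apply/eqP/setP => w; rewrite !inE orbC.
case: (line_segments lx ly (ln _ _ xy') nz qs qs') => -[l0 ->].
  by case: (lz _ nx' l0) => ->; [left|right].
by case: (lz _ ny' l0) => ->; [left|right].
Qed.

End Chords.

(** * Redrawing the attached graph *)

Section Redrawing.
Variables (R : realType) (H : sgraph) (v : H).
Notation plane := (R * R)%type.
Variables (pos : H -> plane) (arc : H -> H -> set plane) (x0 u : plane) (c : R).
Notation D := (drawing pos arc).
Notation F := (connected_component (~` D) x0).
Notation Phi := (chart (pos v) u c).
Hypotheses (emb : planar_embedding pos arc) (u0 : u != 0) (c0 : c != 0).
Hypothesis wedgeF : forall q, wedge q -> F (Phi q).

Definition new_pos (x : attach v) : plane :=
  match x with inl a => pos a | inr i => Phi (parabola (abscissa R i)) end.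

Definition new_arc (x y : attach v) : set plane :=
  match x, y with
  | inl a, inl b => arc a b
  | _, _ => segment (new_pos x) (new_pos y)
  end.

Let Phi_inj : injective Phi := can_inj (chartK (pos v) u0 c0).

Lemma new_posE x : on_gadget x -> new_pos x = Phi (place R x).
Proof. by case: x => [a|i] //= /eqP ->; rewrite chart0. Qed.

Lemma new_arcE x y : gadget_edge x y ->
  new_arc x y = Phi @` segment (place R x) (place R y).
Proof.
move=> xy; have [nx ny] := gadget_edgeP xy.
rewrite -chart_segment -!new_posE //.
by case: x y xy {nx ny} => [a|i] [b|j] //=; rewrite /gadget_edge /= andbF.
Qed.

Lemma new_arc_cap x y : gadget_edge x y -> new_arc x y `<=` Phi @` @cap R.
Proof.
move=> /new_arcE -> _ [q qs <-]; exists q => //.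
by apply: cap_convex qs; exact: place_cap.
Qed.

Lemma pos_drawing a : D (pos a).
Proof. by left; exists a. Qed.

Lemma arc_drawing a b : adj a b -> arc a b `<=` D.
Proof. by move=> ab z abz; right; exists (a, b). Qed.

(** The part of the cap other than its apex is drawn in the face, so it is
    disjoint from the drawing of H. *)
Lemma cap_drawing q : cap q -> D (Phi q) -> q = 0.
Proof.
move=> cq Dq; apply/eqP/negPn/negP => q0.
by have /connected_component_sub := wedgeF (cap_wedge cq q0).
Qed.

Lemma parabola_outside (i : 'I_9) : ~ D (Phi (parabola (abscissa R i))).
Proof. by move=> /(cap_drawing (parabola_cap (abscissa_bound R i))) /parabola_neq0. Qed.

Lemma old_or_new_edge (x y : attach v) : adj x y ->
  (exists a b, [/\ x = inl a, y = inl b & adj a b]) \/ gadget_edge x y.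
Proof.
by case: x y => [a|i] [b|j] xy; rewrite /gadget_edge xy /=; [left; exists a, b|right..].
Qed.

Lemma new_arc_interior x y z : gadget_edge x y ->
  ~ arc_interior new_pos new_arc x y (new_pos z).
Proof.
move=> xy [+ nE]; rewrite new_arcE // => -[q qs qz].
have [nx ny] := gadget_edgeP xy.
have nz : on_gadget z.
  case: z {nE} qz => //= a qz.
  have q0 : q = 0.
    apply: cap_drawing; last by rewrite qz; exact: pos_drawing.
    by apply: cap_convex qs; exact: place_cap.
  by move: qz; rewrite q0 chart0; case: emb => inj _ _ _ /inj ->.
move: qz; rewrite new_posE // => /Phi_inj qz; rewrite qz in qs.
by apply: nE; case: (edge_avoids xy nz qs) => ->; [left|right].
Qed.

Lemma new_planar : planar_embedding new_pos new_arc.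
Proof.
have [inj arcP avoid disj] := emb.
have old_new a b x y z : adj a b -> gadget_edge x y -> arc a b z ->
    new_arc x y z -> z = pos v.
  move=> ab xy abz /(new_arc_cap xy) [q cq qz]; move: abz; rewrite -qz.
  by move=> /(arc_drawing ab) /(cap_drawing cq) ->; rewrite chart0.
have new_inj : injective new_pos.
  move=> [a|i] [b|j] /=.
  - by move=> /inj ->.
  - by move=> E; case: (@parabola_outside j); rewrite -E; exact: pos_drawing.
  - by move=> E; case: (@parabola_outside i); rewrite E; exact: pos_drawing.
  - by move=> /Phi_inj [/abscissa_inj ->].
split=> //.
- move=> x y /old_or_new_edge [[a [b [-> -> ab]]]|xy]; first exact: arcP.
  have [nx ny] := gadget_edgeP xy.
  have -> : new_arc x y = segment (new_pos x) (new_pos y).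
    by rewrite new_arcE // -chart_segment !new_posE.
  have yx : gadget_edge y x.
    by move: xy; rewrite /gadget_edge adj_sym andbC [is_old y && _]andbC andbC.
  split; last by apply: segment_polygonal => /new_inj /eqP; apply/negP/gadget_edge_neq.
  by rewrite new_arcE // -chart_segment -!new_posE // segmentC.
- move=> x y z /old_or_new_edge [[a [b [-> -> ab]]]|xy]; last exact: new_arc_interior.
  case: z => [w|i] [/= abz nE]; first exact: (avoid a b w ab).
  by apply: (@parabola_outside i); exact: arc_drawing abz.
- move=> x y x' y' /old_or_new_edge [[a [b [-> -> ab]]]|xy]
    /old_or_new_edge [[a' [b' [-> -> ab']]]|xy'] neq; apply/seteqP; split=> // z.
  + have neq' : [set a; b]%SET != [set a'; b']%SET.
      apply: contraNneq neq => E; apply/eqP/setP => -[w|i]; rewrite !inE //.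
      by have /setP /(_ w) := E; rewrite !inE.
    by rewrite -(disj a b a' b' ab ab' neq').
  + move=> [[/= abz nE] xyz]; apply: (avoid a b v ab).
    by rewrite -(old_new a b x' y' z).
  + move=> [[xyz nE] /= abz]; apply: (@new_arc_interior x y (inl v) xy) => /=.
    by rewrite -(old_new a' b' x y z).
  + move=> [[+ nE]]; rewrite !new_arcE // => -[q qs qz] [q' qs' q'z].
    have qq' : q' = q by apply: Phi_inj; rewrite qz.
    have [nx ny] := gadget_edgeP xy; apply: nE; rewrite -qz !new_posE //.
    by rewrite qq' in qs'; case: (edges_meet xy xy' neq qs qs') => ->; [left|right].
Qed.

Lemma new_drawing_super : drawing new_pos new_arc `<=` D `|` Phi @` @cap R.
Proof.
move=> z [[[a|i] _ <-]|[[x y] /= /old_or_new_edge [[a [b [-> -> ab]]]|xy] xyz]].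
- by left; exact: pos_drawing.
- by right; exists (parabola (abscissa R i)) => //; exact/parabola_cap/abscissa_bound.
- by left; exact: arc_drawing xyz.
- by right; exact: new_arc_cap xyz.
Qed.

Lemma new_outerplanar : ~ bounded_set F -> (forall a, boundary F (pos a)) ->
  outerplanar R (attach v).
Proof.
move=> unbF bF.
have Dcl := drawing_closed emb; have Dv := pos_drawing v.
pose D' := drawing new_pos new_arc.
exists new_pos, new_arc, (new_face D' (pos v) u c); split; first exact: new_planar.
  split; last exact: (new_face_unbounded Dcl Dv u0 c0 wedgeF new_drawing_super).
  exists (chart (pos v) u c (0, 41 / 2)) => //.
  apply: (fringe_outside u0 c0 wedgeF new_drawing_super).
  split; first by rewrite /wedge /= normr0; split; lra.
  by rewrite /cap /= => -[_]; rewrite expr0n /=; lra.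
move=> x; apply: new_face_boundary; first by left; exists x.
have fringe := closure_fringe u0 c0 wedgeF new_drawing_super.
case: x => [a|i] /=; last exact/fringe/wedgeDcap_closure_parabola/abscissa_bound.
have [->|av] := eqVneq a v.
  by rewrite -{2}(chart0 (pos v) u c); exact/fringe/wedgeDcap_closure0.
apply: (closure_old Dcl Dv u0 c0 wedgeF new_drawing_super); last by case: (bF a).
  exact: pos_drawing.
by case: emb => inj _ _ _ /inj /eqP; apply/negP.
Qed.

End Redrawing.

Lemma attach_outerplanar (R : realType) (H : sgraph) (v : H) :
  outerplanar R H -> outerplanar R (attach v).
Proof.
move=> [pos [arc [F [emb [[x0 Dx0 ->] unbF] bF]]]].
have [u [c [u0 c0 wedgeF]]] := wedge_chart (drawing_closed emb)
  (pos_drawing pos arc v) (drawing_ray_closed emb (pos v)) (bF v).1.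
exact: (new_outerplanar emb u0 c0 wedgeF).
Qed.

Theorem proposition4 (R : realType) (H : sgraph) :
  connected_graph H -> outerplanar R H ->
  exists G : sgraph,
    [/\ connected_graph G, outerplanar R G, induced_subgraph H G
      & ~ pcf_degree_choosable G 1].
Proof.
move=> conH outH; have [/card_gt0P [v _] _] := conH.
exists (attach v); split.
- exact: attach_connected.
- exact: attach_outerplanar.
- exact: attach_induced.
- exact: attach_not_choosable.
Qed.
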